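(* For every $\mathfrak{l}\in\mathfrak{L}$, $\blacktriangleright_{\mathfrak{l}}$ is a pre-Lie product in $T$, and $(T,\{\blacktriangleright_{\mathfrak{l}}\}_{\mathfrak{l}\in\mathfrak{L}})$ is a multi pre-Lie algebra.
   Context: $\mathfrak{L}$ is a finite set, $\mathbb{N}_0=\{0,1,\dots\}$. $M(\mathfrak{L}\times\mathbb{N}_0)$ is the set of finitely supported functions $\beta:\mathfrak{L}\times\mathbb{N}_0\to\mathbb{N}_0$; $\mathsf{z}^\beta=\prod\mathsf{z}_{(\mathfrak{l},k)}^{\beta(\mathfrak{l},k)}$ are monomials in commuting variables; $[\beta]=\sum_{(\mathfrak{l},k)}(1-k)\beta(\mathfrak{l},k)$; $T=\mathrm{span}\{\mathsf{z}^\beta:[\beta]=1\}$; $D=\sum_{(\mathfrak{l},k)}(k+1)\mathsf{z}_{(\mathfrak{l},k+1)}\partial_{\mathsf{z}_{(\mathfrak{l},k)}}$. For $\mathfrak{l}\in\mathfrak{L}$ the bilinear map $\blacktriangleright_{\mathfrak{l}}:T\times T\to T$ is $\mathsf{z}^\beta\blacktriangleright_{\mathfrak{l}}\mathsf{z}^\gamma=\sum_{k\in\mathbb{N}_0}(\frac1{k!}D^k\mathsf{z}^\beta)\,\partial_{\mathsf{z}_{(\mathfrak{l},k)}}\mathsf{z}^\gamma$. A pre-Lie product is a bilinear product with $a\triangleright(b\triangleright c)-(a\triangleright b)\triangleright c=b\triangleright(a\triangleright c)-(b\triangleright a)\triangleright c$. A multi pre-Lie algebra is a vector space with bilinear products $\{\triangleright_{\mathfrak{l}}\}$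 such that $a\triangleright_{\mathfrak{l}}(b\triangleright_{\mathfrak{l}'}c)-(a\triangleright_{\mathfrak{l}}b)\triangleright_{\mathfrak{l}'}c=b\triangleright_{\mathfrak{l}'}(a\triangleright_{\mathfrak{l}}c)-(b\triangleright_{\mathfrak{l}'}a)\triangleright_{\mathfrak{l}}c$ for all $a,b,c$ and all $\mathfrak{l},\mathfrak{l}'$. *)

(* Defs.v *)
From HB Require Import structures.
From mathcomp Require Import all_boot all_order all_algebra.
From mathcomp Require Import finmap.
From mathcomp Require Import monalg.
From mathcomp Require Import boolp classical_sets functions cardinality fsbigop.
From mathcomp Require Import ring.

Set Implicit Arguments.
Unset Strict Implicit.
Unset Printing Implicit Defensive.

Import GRing.Theory.

Local Open Scope ring_scope.

Section PreLie.
Context {K : fieldType} {V : lmodType K}.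

Definition is_bilinear (op : V -> V -> V) : Prop := bilinear_for *:%R *:%R op.

Definition pre_lie_product (op : V -> V -> V) : Prop :=
  is_bilinear op /\
  forall a b c : V,
    op a (op b c) - op (op a b) c = op b (op a c) - op (op b a) c.

Definition multi_pre_lie_algebra (I : Type) (op : I -> V -> V -> V) : Prop :=
  (forall i : I, is_bilinear (op i)) /\
  forall (i j : I) (a b c : V),
    op i a (op j b c) - op j (op i a b) c =
    op j b (op i a c) - op i (op j b a) c.

End PreLie.

Section MultiIndices.
Context (K : fieldType) (L : finType).

Definition multi_index := {cmonom (L * nat)%type}.
HB.instance Definition _ := ConomialDef.on multi_index.

Definition zpoly := {malg K[multi_index]}.
HB.instance Definition _ := GRing.ComAlgebra.on zpoly.

Definition zmon (b : multi_index) : zpoly := << b >>.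

Definition zvar (i : L * nat) : zpoly := zmon (ucm i).

Definition bracket (b : multi_index) : int :=
  \sum_(i <- finsupp b) (1 - i.2%:Z) * (b i)%:Z.

(* The subtraction in [divcm] is truncated; when it matters, i.e. when [b] does
   not contain the variable [i], the coefficient [b i] vanishes. *)
Definition zderiv (i : L * nat) (p : zpoly) : zpoly :=
  \sum_(b <- msupp p) (p@_b * (b i)%:R) *: zmon (divcm b (ucm i)).

(* The two sums below range over infinite types and are finitely supported:
   only finitely many variables occur in a given polynomial. *)
Definition Dop (p : zpoly) : zpoly :=
  \sum_(i \in [set: L * nat])
    i.2.+1%:R *: (zvar (i.1, i.2.+1) * zderiv i p).

Definition zprod (l : L) (p q : zpoly) : zpoly :=
  \sum_(k \in [set: nat]) ((k`!%:R)^-1 *: iter k Dop p) * zderiv (l, k) q.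

Definition Tspan : {pred zpoly} := [pred p : zpoly |
  `[< exists (s : seq multi_index) (c : multi_index -> K),
        (forall b, b \in s -> bracket b = 1) /\
        p = \sum_(b <- s) c b *: zmon b >]].

Definition homog (d : int) (p : zpoly) : Prop :=
  forall b, b \in msupp p -> bracket b = d.

Lemma zpolyE (p : zpoly) : p = \sum_(b <- msupp p) p@_b *: zmon b.
Proof.
rewrite [LHS]monalgE; apply: eq_bigr => b _; apply/malgP => k.
by rewrite mcoeffZ !mcoeffU mulr_natr.
Qed.

Lemma mcoeff_zmon (b k : multi_index) : (zmon b)@_k = (b == k)%:R.
Proof. by rewrite mcoeffU. Qed.

Lemma zderiv_zmon i (b : multi_index) :
  zderiv i (zmon b) = (b i)%:R *: zmon (divcm b (ucm i)).
Proof. by rewrite /zderiv msuppU1 big_seq_fset1 mcoeff_zmon eqxx mul1r. Qed.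

Lemma Dop_zmon (b : multi_index) :
  Dop (zmon b) = \sum_(i <- finsupp b)
    i.2.+1%:R *: (zvar (i.1, i.2.+1) * zderiv i (zmon b)).
Proof.
apply: fsbigTE => i; rewrite -cmE_eq0 => /eqP bi0.
by rewrite zderiv_zmon bi0 scale0r mulr0 scaler0.
Qed.

Lemma zprod_zmon l (b c : multi_index) N :
  (forall k, (N <= k)%N -> c (l, k) = 0%N) ->
  zprod l (zmon b) (zmon c) = \sum_(k < N)
    ((k`!%:R)^-1 *: iter k Dop (zmon b)) * zderiv (l, k : nat) (zmon c).
Proof.
move=> cN; rewrite -(big_mkord xpredT
  (fun k => (k`!%:R^-1 *: iter k Dop (zmon b)) * zderiv (l, k) (zmon c))).
rewrite /zprod (fsbigE (index_iota 0 N)) ?iota_uniq //.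
  by apply: eq_bigl => k; rewrite in_setT.
move=> k _; rewrite mem_index_iota /= -leqNgt => /cN c0.
by rewrite zderiv_zmon c0 scale0r mulr0.
Qed.

Lemma TspanP (p : zpoly) : p \in Tspan <-> homog 1 p.
Proof.
split=> [/asboolP[s [c [sT ->]]] b|pT].
  rewrite -mcoeff_neq0 raddf_sum /= => nz; apply: sT.
  apply: contraNT nz => bs; rewrite big1_seq // => k /andP[_ ks].
  rewrite mcoeffZ mcoeff_zmon; case: eqP => [kb|_]; last by rewrite mulr0.
  by rewrite -kb ks in bs.
by apply/asboolP; exists (msupp p), (fun b => p@_b); split => //; exact: zpolyE.
Qed.

Lemma homog0 d : homog d 0.
Proof. by move=> b; rewrite msupp0. Qed.

Lemma homogD d p q : homog d p -> homog d q -> homog d (p + q).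
Proof.
by move=> hp hq b /(fsubsetP (msuppD_le _ _)); rewrite in_fsetU => /orP[/hp|/hq].
Qed.

Lemma homogZ d c p : homog d p -> homog d (c *: p).
Proof. by move=> hp b /(fsubsetP (msuppZ_le _ _)) /hp. Qed.

Lemma homog_sum d (I : eqType) (s : seq I) (F : I -> zpoly) :
  (forall i, i \in s -> homog d (F i)) -> homog d (\sum_(i <- s) F i).
Proof.
move=> hF; rewrite big_seq; elim/big_ind: _ => //; first exact: homog0.
exact: homogD.
Qed.

Lemma homog_zmon d b : bracket b = d -> homog d (zmon b).
Proof. by move=> hb k; rewrite msuppU1 in_fset1 => /eqP->. Qed.

Lemma bracketEw (b : multi_index) (d : {fset (L * nat)%type}) :
  (finsupp b `<=` d)%fset ->
  bracket b = \sum_(i <- d) (1 - i.2%:Z) * (b i)%:Z.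
Proof.
move=> le; rewrite /bracket (big_fset_incl _ le) // => i _.
by rewrite -cmE_neq0 negbK => /eqP ->; rewrite mulr0.
Qed.

Lemma bracketM (b c : multi_index) :
  bracket (mmul b c) = bracket b + bracket c.
Proof.
rewrite {1}/bracket mdomD (bracketEw (fsubsetUl _ (finsupp c))).
rewrite (bracketEw (fsubsetUr (finsupp b) _)) -big_split /=.
by apply: eq_bigr => i _; rewrite cmM PoszD mulrDr.
Qed.

Lemma bracketU i : bracket (ucm i) = 1 - i.2%:Z.
Proof. by rewrite /bracket mdomU big_seq_fset1 cmUU mulr1. Qed.

Lemma homogM d e p q : homog d p -> homog e q -> homog (d + e) (p * q).
Proof.
move=> hp hq; rewrite [p]zpolyE [q]zpolyE mulr_suml.
apply: homog_sum => b bp; rewrite mulr_sumr; apply: homog_sum => c cq.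
rewrite -scalerAl -scalerAr; do 2 apply: homogZ.
have -> : zmon b * zmon c = zmon (mmul b c).
  by rewrite /zmon [LHS](fgmulUU 1 1 b c) mulr1.
by apply: homog_zmon; rewrite bracketM (hp b bp) (hq c cq).
Qed.

Lemma homog_zderiv d i p : homog d p -> homog (d - (1 - i.2%:Z)) (zderiv i p).
Proof.
move=> hp; apply: homog_sum => b bp; have [bi0|bi] := eqVneq (b i) 0%N.
  by rewrite bi0 mulr0 scale0r; exact: homog0.
apply/homogZ/homog_zmon; rewrite -(hp b bp) -bracketU.
have {2}-> : b = mmul (divcm b (ucm i)) (ucm i).
  apply/eqP/cmP => j; rewrite cmM divcmE ucmE.
  by case: eqP => [<-|_]; rewrite ?subn0 ?addn0 // subnK // lt0n.
by rewrite bracketM addrK.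
Qed.

Lemma homog_Dop d p : homog d p -> homog (d - 1) (Dop p).
Proof.
move=> hp; apply: homog_sum => i _; apply: homogZ.
have -> : d - 1 = (1 - i.2.+1%:Z) + (d - (1 - i.2%:Z)) by rewrite intS; ring.
apply: homogM; last exact: homog_zderiv.
by apply: homog_zmon; rewrite bracketU.
Qed.

Lemma homog_iter_Dop d k p : homog d p -> homog (d - k%:Z) (iter k Dop p).
Proof.
move=> hp; elim: k => [|k IH]; first by rewrite subr0.
have -> : d - k.+1%:Z = d - k%:Z - 1 by rewrite intS; ring.
exact: homog_Dop.
Qed.

Fact zprod_Tspan l p q : p \in Tspan -> q \in Tspan -> zprod l p q \in Tspan.
Proof.
move=> /TspanP hp /TspanP hq; apply/TspanP; apply: homog_sum => k _.
have -> : 1%R = (1 - k%:Z) + (1 - (1 - k%:Z)) by ring.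
by apply: homogM; [apply/homogZ/homog_iter_Dop | apply: homog_zderiv].
Qed.

Fact Tspan_submod : subsemimod_closed Tspan.
Proof.
split; first split; first exact/TspanP/homog0.
- by move=> p q /TspanP hp /TspanP hq; apply/TspanP/homogD.
- by move=> c p /TspanP hp; apply/TspanP/homogZ.
Qed.

Record Tspace : predArgType := MkTspace { T_val :> zpoly; T_valP : T_val \in Tspan }.
HB.instance Definition _ := [isSub of Tspace for T_val].
HB.instance Definition _ := [Choice of Tspace by <:].
HB.instance Definition _ :=
  GRing.SubChoice_isSubLmodule.Build K zpoly Tspan Tspace Tspan_submod.

Definition btr (l : L) (p q : Tspace) : Tspace :=
  MkTspace (zprod_Tspan l (T_valP p) (T_valP q)).

End MultiIndices.

(* Main.v *)
Require Import Defs.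
From HB Require Import structures.
From mathcomp Require Import all_boot all_order all_algebra.
From mathcomp Require Import finmap monalg.
From mathcomp Require Import boolp classical_sets fsbigop.
From mathcomp Require Import ring.

Set Implicit Arguments.
Unset Strict Implicit.
Unset Printing Implicit Defensive.

Import GRing.Theory.

(** For fixed [l] and [p], the operator [zprod l p] is a vector field, that is,
    of the form [q |-> \sum_i f i * d_i q] for the commuting partial derivatives
    [d_i] and polynomial coefficients [f i]; so is [Dop].  Polynomial vector fields
    on an affine space carry the pre-Lie product [f |> g = \sum_i f (g i) * d_i]
    of the flat connection: since
      [f (g q) = (f |> g) q + \sum_(i, j) f i * g j * d_i (d_j q)]
    and the second-order part is symmetric in [f] and [g], the difference
    [f (g q) - (f |> g) q] is symmetric ([vfield_pre_lie]).

    The multi pre-Lie identity is this symmetry for the vector fields of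
    [zprod l a] and [zprod l' b], once it is known that
    [zprod l a |> zprod l' b] is the vector field of [zprod l' (zprod l a b)]
    ([tri_coefM]).  The coefficients of [zprod l' b] are the elements
    [Dop^k b / k!], so this says that the operator [zprod l a] commutes with
    [Dop] ([tri_shift]).  Two vector fields [f] and [g] commute as soon as
    [f |> g = g |> f], which is an equality of coefficients; for [zprod l a] and
    [Dop] it reads [(k + 1) * (Dop^(k+1) a / (k+1)!) = Dop (Dop^k a / k!)].
    Characteristic zero enters here, to cancel [k + 1] in the factorial.

    The argument is carried out in a commutative algebra with commuting,
    locally finite derivations dual to a family of coordinates.  The polynomial
    ring then only has to supply the Leibniz rule, the commutation of partial
    derivatives, their local finiteness, and their values on the variables. *)

Local Open Scope classical_set_scope.
Local Open Scope ring_scope.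

(** * Linear maps on a spanning family *)

Section SpanningFamily.
Context (K : fieldType) (A : comAlgType K) (B : Type) (m : B -> A).
Context (span : forall p : A, exists (s : seq B) (c : B -> K),
  p = \sum_(b <- s) c b *: m b).

Lemma linear_eq_on_span (f g : {linear A -> A}) :
  (forall b, f (m b) = g (m b)) -> f =1 g.
Proof.
move=> fg p; have [s [c ->]] := span p; rewrite !linear_sum.
by apply: eq_bigr => b _; rewrite !linearZ /= fg.
Qed.

Lemma leibniz_on_span (f : {linear A -> A}) :
  (forall b c, f (m b * m c) = f (m b) * m c + m b * f (m c)) ->
  forall p q, f (p * q) = f p * q + p * f q.
Proof.
move=> fM p q; have [s [c ->]] := span p; have [t [e ->]] := span q.
rewrite !(linear_sum, mulr_suml) -big_split /=; apply: eq_bigr => b _.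
rewrite !(linear_sum, mulr_sumr) -big_split /=; apply: eq_bigr => b' _.
rewrite -!(scalerAl, scalerAr) !linearZ /= -!(scalerAl, scalerAr) fM !scalerDr.
by rewrite !scalerA [e b' * _]mulrC.
Qed.

End SpanningFamily.

(** * Vector fields *)

Section VectorFields.
Context (K : fieldType) (A : comAlgType K) (I : choiceType).
Context (d : I -> {linear A -> A}).
Implicit Types (p q : A) (i j : I) (f g : I -> A).

Definition vfield f q : A := \sum_(i \in [set: I]) f i * d i q.

Context (dM : forall i p q, d i (p * q) = d i p * q + p * d i q).
Context (dC : forall i j p, d i (d j p) = d j (d i p)).
Context (d_fin : forall p,
  exists S : {fset I}, forall i, i \notin S -> d i p = 0).

(** The sum over all indices becomes a sum over any finite set that contains the
    directions in which [q] varies, so that several such sums can be compared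
    over one common set. *)
Lemma vfieldE (S : {fset I}) f q :
  (forall i, i \notin S -> d i q = 0) ->
  vfield f q = \sum_(i <- S) f i * d i q.
Proof. by move=> qS; apply: fsbigTE => i /qS ->; rewrite mulr0. Qed.

Lemma common_support p q : exists S : {fset I},
  (forall i, i \notin S -> d i p = 0) /\ (forall i, i \notin S -> d i q = 0).
Proof.
have [[S pS] [T qT]] := (d_fin p, d_fin q); exists (S `|` T)%fset.
by split=> i; rewrite in_fsetU negb_or => /andP[iS iT]; [apply: pS|apply: qT].
Qed.

Fact vfield_is_linear f : linear (vfield f).
Proof.
move=> a p q; have [S [pS qS]] := common_support p q.
rewrite (vfieldE f pS) (vfieldE f qS) (vfieldE (S := S)) => [|i iS]; last first.
  by rewrite linearP pS // qS // scaler0 addr0.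
rewrite scaler_sumr -big_split; apply: eq_bigr => i _ /=.
by rewrite linearP mulrDr scalerAr.
Qed.
HB.instance Definition _ f :=
  GRing.isLinear.Build K A A *:%R (vfield f) (vfield_is_linear f).

Lemma vfield0 f : vfield f 0 = 0.
Proof. exact: linear0. Qed.

Lemma vfieldZ f a q : vfield f (a *: q) = a *: vfield f q.
Proof. exact: linearZ. Qed.

Lemma vfield_linearl a f g q :
  vfield (fun i => a *: f i + g i) q = a *: vfield f q + vfield g q.
Proof.
have [S qS] := d_fin q; rewrite !(vfieldE _ qS) scaler_sumr -big_split.
by apply: eq_bigr => i _ /=; rewrite mulrDl scalerAl.
Qed.

Lemma vfieldM f p q : vfield f (p * q) = vfield f p * q + p * vfield f q.
Proof.
have [S [pS qS]] := common_support p q.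
rewrite (vfieldE f pS) (vfieldE f qS) (vfieldE (S := S)) => [|i iS]; last first.
  by rewrite dM pS // qS // mul0r mulr0 addr0.
rewrite mulr_suml mulr_sumr -big_split; apply: eq_bigr => i _ /=.
by rewrite dM; ring.
Qed.

(** By the Leibniz rule each side is the second-order part of the composite
    operator, which is symmetric because the derivations [d] commute. *)
Lemma vfield_pre_lie f g q :
  vfield f (vfield g q) - vfield (vfield f \o g) q =
  vfield g (vfield f q) - vfield (vfield g \o f) q.
Proof.
have [S qS] := d_fin q.
have comp h k : vfield h (vfield k q) - vfield (vfield h \o k) q =
    \sum_(j <- S) \sum_(i <- S) h i * k j * d i (d j q).
  rewrite 2!(vfieldE _ qS) linear_sum -sumrB /=; apply: eq_bigr => j _.
  rewrite vfieldM addrC addKr (vfieldE (S := S)) => [|i iS]; last first.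
    by rewrite dC qS // linear0.
  by rewrite mulr_sumr; apply: eq_bigr => i _; ring.
rewrite !comp exchange_big /=; apply: eq_bigr => i _; apply: eq_bigr => j _.
by rewrite dC [f i * _]mulrC.
Qed.

(** The commutator of two vector fields is the vector field whose coefficients
    are [f (g i) - g (f i)], so it suffices to compare coefficients. *)
Lemma vfield_commute f g : vfield f \o g =1 vfield g \o f ->
  forall q, vfield f (vfield g q) = vfield g (vfield f q).
Proof.
by move=> /funext fg q; have := vfield_pre_lie f g q; rewrite fg => /addIr.
Qed.

End VectorFields.

(** * The triangle products in dual coordinates *)

Section TriangleProducts.
Context (K : fieldType) (charK : [pchar K] =i pred0) (A : comAlgType K).
Context (L : choiceType) (x : L * nat -> A) (d : L * nat -> {linear A -> A}).
Implicit Types (p q : A) (l : L) (i j : L * nat) (k : nat).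

Definition shift p : A :=
  \sum_(i \in [set: L * nat]) i.2.+1%:R *: (x (i.1, i.2.+1) * d i p).

Definition tri l p q : A :=
  \sum_(k \in [set: nat]) ((k`!%:R)^-1 *: iter k shift p) * d (l, k) q.

Context (dM : forall i p q, d i (p * q) = d i p * q + p * d i q).
Context (dC : forall i j p, d i (d j p) = d j (d i p)).
Context (d_fin : forall p,
  exists S : {fset L * nat}, forall i, i \notin S -> d i p = 0).
Context (dx : forall i j, d i (x j) = (i == j)%:R).

Lemma vfield_coord f i : vfield d f (x i) = f i.
Proof.
rewrite (vfieldE (S := [fset i]%fset)) => [|j]; rewrite ?in_fset1.
  by rewrite big_seq_fset1 dx eqxx mulr1.
by move=> /negPf ji; rewrite dx ji.
Qed.

Definition shift_coef i : A := i.2.+1%:R *: x (i.1, i.2.+1).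

Definition tri_coef l p i : A :=
  if i.1 == l then (i.2)`!%:R^-1 *: iter i.2 shift p else 0.

Lemma shiftE : shift = vfield d shift_coef.
Proof. by apply/funext => p; apply: eq_fsbigr => i _; rewrite scalerAl. Qed.

(** Only the directions [(l, k)] contribute, which turns the sum over [k] into a
    sum over all coordinates. *)
Lemma triE l p q : tri l p q = vfield d (tri_coef l p) q.
Proof.
rewrite /tri /vfield.
rewrite -[RHS](@fsbig_widen _ _ _ _ [set (l, k) | k in [set: nat]]) //; last first.
  move=> [l' k] [_ /= nl]; rewrite /tri_coef /=; case: eqP => [ll|_].
    by case: nl; exists k; rewrite ?ll.
  by rewrite mul0r.
rewrite fsbig_image; last by move=> k k' _ _ [].
by apply: eq_fsbigr => k _; rewrite /tri_coef /= eqxx.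
Qed.

Lemma iter_shift_linear k : linear (iter k shift).
Proof.
elim: k => // k IH a p q.
by rewrite !iterS IH shiftE; apply: vfield_is_linear.
Qed.

Lemma tri_bilinear l : is_bilinear (tri l).
Proof.
split=> [q|p] a u v; rewrite !triE; last exact: vfield_is_linear.
rewrite -vfield_linearl //; congr vfield; apply/funext => i; rewrite /tri_coef.
case: eqP => _; last by rewrite scaler0 addr0.
by rewrite iter_shift_linear scalerDr !scalerA mulrC.
Qed.

Lemma natr_mul_factV k : k.+1%:R * (k.+1)`!%:R^-1 = k`!%:R^-1 :> K.
Proof.
by rewrite factS natrM invfM mulVKf // ((pcharf0P K).1 charK).
Qed.

(** Both operators are vector fields, and at the coordinate [(l, k)] the
    coefficients to compare are [(k + 1) * shift^(k+1) p / (k+1)!] and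
    [shift (shift^k p / k!)]; at the other coordinates both vanish. *)
Lemma tri_shift l p q : tri l p (shift q) = shift (tri l p q).
Proof.
rewrite !triE shiftE; apply: vfield_commute => // -[l' k].
rewrite -shiftE /= vfieldZ // vfield_coord /tri_coef /=.
case: eqP => _; last by rewrite scaler0 shiftE vfield0.
by rewrite scalerA natr_mul_factV shiftE vfieldZ.
Qed.

(** The vector field of an iterated product is the pre-Lie product of the two
    vector fields; this is what reduces the multi pre-Lie identity to
    [vfield_pre_lie]. *)
Lemma tri_coefM l l' p q i :
  tri_coef l' (tri l p q) i = tri l p (tri_coef l' q i).
Proof.
have comm k : tri l p (iter k shift q) = iter k shift (tri l p q).
  by elim: k => // k IH; rewrite !iterS tri_shift IH.
rewrite /tri_coef; case: eqP => _; rewrite [RHS]triE.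
  by rewrite vfieldZ // -triE comm.
by rewrite vfield0.
Qed.

Theorem tri_multi_pre_lie : multi_pre_lie_algebra tri.
Proof.
split=> [l|l l' a b c]; first exact: tri_bilinear.
have assoc m m' u v :
    tri m' (tri m u v) c =
    vfield d (vfield d (tri_coef m u) \o tri_coef m' v) c.
  rewrite triE; congr vfield; apply/funext => i.
  by rewrite tri_coefM triE.
by rewrite !assoc !triE; exact: vfield_pre_lie.
Qed.

End TriangleProducts.

(** * Partial derivatives of polynomials *)

Section PartialDerivatives.
Context (K : fieldType) (L : finType).
Implicit Types (b c : multi_index L) (p q : zpoly K L) (i j : L * nat).

Lemma zmonM b c : zmon K b * zmon K c = zmon K (mmul b c).
Proof. by rewrite /zmon [LHS](fgmulUU 1 1 b c) mulr1. Qed.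

Lemma zmon_span p : exists (s : seq (multi_index L)) (c : multi_index L -> K),
  p = \sum_(b <- s) c b *: zmon K b.
Proof. by exists (msupp p), (fun b => p@_b); exact: zpolyE. Qed.

Lemma zderiv_widen (S : {fset multi_index L}) i p : (msupp p `<=` S)%fset ->
  zderiv i p = \sum_(b <- S) (p@_b * (b i)%:R) *: zmon K (divcm b (ucm i)).
Proof.
move=> sub; rewrite /zderiv (big_fset_incl _ sub) // => b _ /mcoeff_outdom ->.
by rewrite mul0r scale0r.
Qed.

Fact zderiv_is_linear i : linear (@zderiv K L i).
Proof.
move=> a p q; pose S := (msupp p `|` msupp q)%fset.
have subS : (msupp (a *: p + q) `<=` S)%fset.
  apply: fsubset_trans (msuppD_le _ _) _.
  exact: fsetUSS (msuppZ_le _ _) (fsubset_refl _).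
rewrite (zderiv_widen _ subS) (zderiv_widen _ (fsubsetUl _ (msupp q))).
rewrite (zderiv_widen _ (fsubsetUr (msupp p) _)) scaler_sumr -big_split /=.
by apply: eq_bigr => b _; rewrite mcoeffD mcoeffZ mulrDl scalerDl scalerA mulrA.
Qed.
HB.instance Definition _ i :=
  GRing.isLinear.Build K (zpoly K L) (zpoly K L) *:%R (@zderiv K L i)
    (zderiv_is_linear i).

Lemma divcm_mulr i b c : b i != 0%N ->
  divcm (mmul b c) (ucm i) = mmul (divcm b (ucm i)) c.
Proof.
move=> bi; apply/eqP/cmP => j; rewrite divcmE !cmM divcmE ucmE.
by case: eqP => [<-|_]; rewrite ?subn0 // addnBAC // lt0n.
Qed.

(** One half of the Leibniz rule on monomials.  The scalar [b i] is kept because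
    the division of [b] by the variable [i] is truncated: when [b i] vanishes
    the two monomials may differ, but both sides are zero. *)
Lemma zderiv_zmonMl i b c : (b i)%:R *: zmon K (divcm (mmul b c) (ucm i)) =
  zderiv i (zmon K b) * zmon K c.
Proof.
rewrite zderiv_zmon -scalerAl zmonM.
have [bi0|bi] := eqVneq (b i) 0%N; first by rewrite bi0 [LHS]scale0r scale0r.
by rewrite divcm_mulr.
Qed.

(** On monomials, the exponent of [i] in [b c] is [b i + c i], and each summand
    accounts for differentiating one of the two factors. *)
Lemma zderivM i p q : zderiv i (p * q) = zderiv i p * q + p * zderiv i q.
Proof.
move: p q; apply: (leibniz_on_span zmon_span) => b c.
rewrite (zmonM b c) [LHS]zderiv_zmon [in LHS]cmM [in LHS]natrD [LHS]scalerDl.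
rewrite (zderiv_zmonMl i b c) [X in divcm X]mulmC (zderiv_zmonMl i c b).
by rewrite [in RHS](mulrC (zmon K b)).
Qed.

Lemma zderivC i j p : zderiv i (zderiv j p) = zderiv j (zderiv i p).
Proof.
have [->//|ij] := eqVneq i j.
move: p; apply: (linear_eq_on_span zmon_span
  (f := @zderiv K L i \o @zderiv K L j) (g := @zderiv K L j \o @zderiv K L i)).
move=> b; have divC :
    divcm (divcm b (ucm i)) (ucm j) = divcm (divcm b (ucm j)) (ucm i).
  by apply/eqP/cmP => k; rewrite !divcmE subnAC.
rewrite /= !zderiv_zmon !linearZ /= !zderiv_zmon !divcmE !ucmE (negPf ij).
by rewrite eq_sym (negPf ij) !subn0 divC scalerA mulrC -scalerA.
Qed.

Lemma zderiv_zvar i j : zderiv i (zvar K j) = (i == j)%:R.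
Proof.
rewrite zderiv_zmon ucmE eq_sym; case: eqP => [->|_]; last by rewrite scale0r.
rewrite scale1r; congr (zmon K _); apply/eqP/cmP => k.
by rewrite divcmE subnn cm1.
Qed.

Lemma zderiv_fin p : exists S : {fset L * nat},
  forall i, i \notin S -> zderiv i p = 0.
Proof.
exists (\bigcup_(b <- msupp p) finsupp b)%fset => i ip.
rewrite /zderiv big_seq big1 // => b bp.
suff /eqP-> : b i == 0%N by rewrite mulr0 scale0r.
rewrite cmE_eq0; apply: contra ip => ib.
by apply/bigfcupP; exists b; rewrite ?bp.
Qed.

End PartialDerivatives.

Theorem corollary4p4 (K : fieldType) (charK : [pchar K]%R =i pred0)
    (L : finType) :
  (forall l : L, pre_lie_product (V := Tspace K L) (btr (K := K) l)) /\
  multi_pre_lie_algebra (V := Tspace K L) (btr (K := K) (L := L)).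
Proof.
have [bil pre] : multi_pre_lie_algebra (@zprod K L).
  exact: (@tri_multi_pre_lie K charK (zpoly K L) L (@zvar K L)
    (fun i => @zderiv K L i) (@zderivM K L) (@zderivC K L) (@zderiv_fin K L)
    (@zderiv_zvar K L)).
have multi : multi_pre_lie_algebra (V := Tspace K L) (btr (K := K) (L := L)).
  split=> [l|l l' a b c]; last by apply: val_inj; rewrite !raddfB; exact: pre.
  by split=> [q|p] a u v; apply: val_inj; [exact: (bil l).1|exact: (bil l).2].
by split=> [l|//]; split; [exact: multi.1|move=> a b c; exact: multi.2].
Qed.
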